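(* Let $f,g$ be non-degenerate real ternary quadratic forms. If $f,g$ generate a pencil in orbit V, then the conic $[f=0]$ lies inside the conic $[g=0]$ if and only if $T<0$.
   Context: $[f=0]\subset\mathbb{RP}^2$ is the zero locus of $f$. A proper non-empty conic cuts $\mathbb{RP}^2$ into two connected components, one homeomorphic to a Möbius strip (outside), the other to an open disk (inside); the inside of $[f=0]$ is the set of points where $f$ takes the sign of $\det\mathrm{Matrix}(f)$, where $\mathrm{Matrix}(f)$ is the symmetric matrix of $f$. ''$[f=0]$ lies inside $[g=0]$'' means that $[f=0]$ is contained in the inside of $[g=0]$ except for the common point(s) (base points) of the two conics. Orbit V is the $PGL(3,\mathbb{R})$-orbit of the pencil of conics (projective line in $\mathbb{P}(S^2{\mathbb{R}^3}^* )$) generated by $xz-y^2$ and $x^2$; saying that $f,g$ generate a pencil in orbit V means that $f,g$ are non-proportional and the line through $[f],[g]$ is in this orbit. Write $\det\mathrm{Matrix}(tf+ug)=\Phi_{30}t^3+\Phi_{21}t^2u+\Phi_{12}tu^2+\Phi_{03}u^3$. The antisymmetric covariant is the quadratic form $\mathcal{B}(f,g)=\Phi_{12}f-\Phi_{21}g$, and $T=\mathrm{tr}(\mathrm{Matrix}(\mathcal{B}(f,g)))$. *)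

(* Defs.v *)
From mathcomp Require Import all_boot all_order all_algebra reals.
From mathcomp Require Import mpoly.

Set Implicit Arguments.
Unset Strict Implicit.
Unset Printing Implicit Defensive.

Import Order.TTheory GRing.Theory Num.Theory.
Local Open Scope ring_scope.

(* Real ternary quadratic forms are the f : {mpoly R[3]} with f \is 2.-homog.
   Points of RP^2 are given by homogeneous coordinates, that is by nonzero row
   vectors; all the point sets below are invariant under nonzero scaling. *)

Section Conics.
Variable R : realType.
Implicit Types (f g h : {mpoly R[3]}) (A : 'M[R]_3) (v : 'rV[R]_3).

(* The symmetric matrix of f, characterized by f(v) = v (form_matrix f) v^T: an
   off-diagonal entry is half the coefficient of the mixed monomial. *)
Definition form_matrix f : 'M[R]_3 :=
  \matrix_(i, j) if i == j then f@_(U_(i) + U_(i))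
                 else f@_(U_(i) + U_(j)) / 2.

Definition nondegenerate_form f : bool := \det (form_matrix f) != 0.

Definition zero_locus f : {pred 'rV[R]_3} :=
  [pred v : 'rV[R]_3 | (v != 0) && (f.@[v 0] == 0)].

(* f has even degree, so the sign of f.@[v 0] depends only on the point [v]. *)
Definition inside f : {pred 'rV[R]_3} :=
  [pred v : 'rV[R]_3 | (v != 0) && (Num.sg f.@[v 0] == Num.sg (\det (form_matrix f)))].

Definition lies_inside f g : Prop :=
  forall v, v \in zero_locus f -> v \notin zero_locus g -> v \in inside g.

Definition non_proportional f g : Prop :=
  forall t u : R, t *: f + u *: g = 0 -> t = 0 /\ u = 0.

(* The projective line through [f] and [g], as the linear span of f and g. *)
Definition pencil f g h : Prop := exists t u : R, h = t *: f + u *: g.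

(* The action of GL(3,R) on forms by linear change of variables:
   (lin_subst A f)(x) = f(A x). Its orbits on pencils are those of PGL(3,R). *)
Definition lin_subst A f : {mpoly R[3]} :=
  f \mPo [tuple \sum_(j < 3) A i j *: 'X_j | i < 3].

Definition orbitV_conic1 : {mpoly R[3]} := 'X_0 * 'X_2 - 'X_1 ^+ 2.
Definition orbitV_conic2 : {mpoly R[3]} := 'X_0 ^+ 2.

Definition generate_pencil_in_orbitV f g : Prop :=
  non_proportional f g /\
  exists2 A : 'M[R]_3, A \in unitmx &
    forall h, pencil f g h <->
      pencil (lin_subst A orbitV_conic1) (lin_subst A orbitV_conic2) h.

(* det form_matrix (t f + u g) as a polynomial in the indeterminates t = 'X_0 and
   u = 'X_1. *)
Definition det_pencil f g : {mpoly R[2]} :=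
  \det ('X_0 *: map_mx (@mpolyC 2 R) (form_matrix f)
        + 'X_1 *: map_mx (@mpolyC 2 R) (form_matrix g)).

(* The coefficient of t^i u^j. *)
Definition Phi f g (i j : nat) : R :=
  (det_pencil f g)@_[multinom [tuple i; j]].

Definition antisym_covariant f g : {mpoly R[3]} :=
  Phi f g 1 2 *: f - Phi f g 2 1 *: g.

Definition T_invariant f g : R := \tr (form_matrix (antisym_covariant f g)).

End Conics.

(* Main.v *)
Require Import Defs.
From mathcomp Require Import all_boot all_order all_algebra reals.
From mathcomp Require Import mpoly ring lra.
Import Order.TTheory GRing.Theory Num.Theory.
Local Open Scope ring_scope.

(** Let [P] and [Q] be the pullbacks of [x z - y^2] and [x^2] by the linear
    change of variables [A] that puts the pencil in normal form, and write
    [f = a P + b Q], [g = c P + d Q], [e = a d - b c].  Then everything is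
    governed by the sign of [a c e].

    In the basis [P, Q] the determinant does not see [Q]: it is
    [det (s P + t Q) = k s^3] with [k = (det A / 2)^2 > 0]
    ([det_congruent_normal_matrix], [form_matrix_pencil]).  So [a] and [c] are
    nonzero when [f] and [g] are nondegenerate, and
    [det (t f + u g) = k (a t + c u)^3], whose middle coefficients are
    [Phi21 = 3 k a^2 c] and [Phi12 = 3 k a c^2].  In [Phi12 f - Phi21 g] the
    form [P] cancels and [- 3 k a c e Q] remains.  As [Q] is the square of the
    linear form given by the first row of [A], its trace is the squared length
    of that row, which is positive; hence [T < 0] exactly when [a c e > 0]
    ([T_invariantE]).

    On the conic [f = 0] one has [P = - (b / a) Q], so [g = (e / a) Q] there.
    Since [Q] is a square, [g] has the sign of [e / a] at every point of
    [f = 0] off [g = 0], and [det g = k c^3] has the sign of [c].  Hence such a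
    point is inside [g = 0] exactly when [a c e > 0]
    ([inside_on_zero_locus]).  One such point is needed for the equivalence,
    and the normal form supplies it ([exists_zero_locus_diff]). *)

(** * Matrices of the pencil in normal form *)

(** For [h = 1/2] this is the symmetric matrix of [s (x z - y^2) + t x^2].  The
    constant [h] is a parameter so that the same matrix makes sense over the
    ring of polynomials in the pencil parameters. *)
Definition normal_matrix {S : comNzRingType} (h s t : S) : 'M[S]_3 :=
  \matrix_(i, j) nth 0 (nth [::] [:: [::     t;   0; h * s];
                                      [::     0; - s;     0];
                                      [:: h * s;   0;     0]] i) j.

Lemma normal_matrixD {S : comNzRingType} (h x y s t s' t' : S) :
  x *: normal_matrix h s t + y *: normal_matrix h s' t' =
  normal_matrix h (x * s + y * s') (x * t + y * t').
Proof.
by apply/matrixP=> -[[|[|[|i]]] hi] -[[|[|[|j]]] hj] //; rewrite !mxE /=; ring.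
Qed.

Lemma map_normal_matrix {S S' : comNzRingType} (phi : {rmorphism S -> S'})
    (h s t : S) :
  map_mx phi (normal_matrix h s t) = normal_matrix (phi h) (phi s) (phi t).
Proof.
by apply/matrixP=> -[[|[|[|i]]] hi] -[[|[|[|j]]] hj] //;
   rewrite !mxE /= ?rmorph0 ?rmorphN ?rmorphM.
Qed.

Lemma det_congruent_normal_matrix {S : comNzRingType} (A : 'M[S]_3) (h s t : S) :
  \det (A^T *m normal_matrix h s t *m A) = (\det A * h) ^+ 2 * s ^+ 3.
Proof.
rewrite !det_mulmx det_tr.
suff -> : \det (normal_matrix h s t) = h ^+ 2 * s ^+ 3 by ring.
rewrite (expand_det_row _ ord0) !big_ord_recl big_ord0 !mxE /=.
rewrite /cofactor !(expand_det_row _ ord0) !big_ord_recl !big_ord0 !mxE /=.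
by rewrite /cofactor !det_mx11 !mxE /=; ring.
Qed.

(** * Coefficients of polynomials *)

(** The coefficient of a mixed monomial in a product of two linear forms has two
    terms, one for each alternative below. *)
Lemma mnm1D_eq n (i j k l : 'I_n) :
  ((U_(k) + U_(l))%MM == (U_(i) + U_(j))%MM :> 'X_{1.. n}) =
  (k == i) && (l == j) || (k == j) && (l == i).
Proof.
apply/eqP/idP => [E|]; last first.
  by case/orP=> /andP[/eqP-> /eqP->] //; rewrite addmC.
(* The exponent of the variable k forces k = i or k = j; then cancel it. *)
have := congr1 (fun u : 'X_{1.. n} => u k) E.
rewrite !mnmDE !mnm1E eqxx.
case: (eqVneq i k) E => [-> /addmI/eqP | _ E].
  by rewrite eq_mnm1 => ->.
case: (eqVneq j k) E => [-> | //].
by rewrite addmC => /addIm/eqP; rewrite eq_mnm1 => ->.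
Qed.

(** This computes [Phi12] and [Phi21], as the determinant of the pencil is
    the multiple of a cube. *)
Lemma mcoeff_cube {S : comNzRingType} (k a c : S) :
  let p : {mpoly S[2]} := k%:MP * ('X_0 * a%:MP + 'X_1 * c%:MP) ^+ 3 in
  p@_[multinom [tuple 1%N; 2%N]] = 3 * k * a * c ^+ 2 /\
  p@_[multinom [tuple 2%N; 1%N]] = 3 * k * a ^+ 2 * c.
Proof.
move=> p.
pose M i j : 'X_{1.. 2} := (U_(0%R) *+ i + U_(1%R) *+ j)%MM.
have ME i j : [multinom [tuple i; j]] = M i j.
  apply/mnmP=> u; rewrite mnmDE !mulmnE !mnm1E multinomE.
  by case: u => [[|[|u]] hu] //=; rewrite (tnth_nth 0%N) /= ?mul0n ?mul1n ?addn0.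
have pE : p = (k * a ^+ 3) *: 'X_[M 3 0]%N + (3 * k * a ^+ 2 * c) *: 'X_[M 2 1]%N
   + (3 * k * a * c ^+ 2) *: 'X_[M 1 2]%N + (k * c ^+ 3) *: 'X_[M 0 3]%N.
  rewrite /p /M !mpolyXD -!mpolyXn -!mul_mpolyC ?mul1r.
  by ring.
split; rewrite pE !mcoeffD !mcoeffZ !mcoeffX -!ME.
  by rewrite !eqE /=; ring.
by rewrite !eqE /=; ring.
Qed.

Lemma sgr_eq_mulr_gt0 {K : realDomainType} (x y : K) :
  y != 0 -> (Num.sg x == Num.sg y) = (0 < x * y).
Proof.
rewrite -[0 < _]sgr_gt0 sgrM => y0.
by case: (sgrP x) => _; case: (sgrP y) y0 => // _; rewrite ?eqxx //; lra.
Qed.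

(** * Conics of the pencil *)

Section RealConics.
Set Implicit Arguments.
Unset Strict Implicit.
Variable R : realType.

Lemma form_matrix_lin (x y : R) (f g : {mpoly R[3]}) :
  form_matrix (x *: f + y *: g) = x *: form_matrix f + y *: form_matrix g.
Proof.
apply/matrixP=> i j; rewrite !mxE.
by case: eqP => _; rewrite mcoeffD !mcoeffZ; ring.
Qed.

(** The symmetric matrix of a product of two linear forms is the symmetrized
    tensor product of their coefficient vectors; both conics of the normal form
    are built from such products. *)
Lemma form_matrixM (a b : 'I_3 -> R) :
  form_matrix ((\sum_j a j *: 'X_j) * (\sum_j b j *: 'X_j)) =
  \matrix_(i, j) ((a i * b j + a j * b i) / 2).
Proof.
have coefE i j : ((\sum_j a j *: 'X_j) * (\sum_j b j *: 'X_j))@_(U_(i) + U_(j)) =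
    \sum_k \sum_l a k * b l * ((k == i) && (l == j) || (k == j) && (l == i))%:R.
  rewrite mulr_suml raddf_sum; apply: eq_bigr => k _.
  rewrite mulr_sumr raddf_sum; apply: eq_bigr => l _ /=.
  by rewrite -scalerAl -scalerAr -mpolyXD !mcoeffZ mcoeffX mnm1D_eq mulrA.
have pick i j : \sum_k \sum_l a k * b l * ((k == i) && (l == j))%:R = a i * b j.
  rewrite (bigD1 i) //= (bigD1 j) //= !eqxx mulr1 !big1 ?addr0 //.
    by move=> k /negPf ki; apply: big1 => l _; rewrite ki mulr0.
  by move=> l /negPf ->; rewrite andbF mulr0.
apply/matrixP=> i j; rewrite !mxE !coefE.
case: eqVneq => [->|/negPf ij].
  under eq_bigr do under eq_bigr do rewrite orbb.
  by rewrite pick; field.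
rewrite -[a i * b j]pick -[a j * b i]pick -big_split; congr (_ / 2).
apply: eq_bigr => k _; rewrite -big_split; apply: eq_bigr => l _ /=.
rewrite -mulrDr; congr (_ * _).
case: (eqVneq k i) => [->|_]; last by rewrite !add0r.
by rewrite ij /= orbF addr0.
Qed.

Variable A : 'M[R]_3.
Local Notation P := (lin_subst A (orbitV_conic1 R)).
Local Notation Q := (lin_subst A (orbitV_conic2 R)).
Local Notation L i := (\sum_j A i j *: 'X_j : {mpoly R[3]}).

Lemma lin_subst_conic1 : P = L 0 * L 2 - L 1 * L 1.
Proof.
rewrite /lin_subst /orbitV_conic1 comp_mpolyB rmorphM rmorphXn /=.
by rewrite !comp_mpolyXU -!tnth_nth !tnth_mktuple expr2.
Qed.

Lemma lin_subst_conic2 : Q = L 0 * L 0.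
Proof.
rewrite /lin_subst /orbitV_conic2 rmorphXn /=.
by rewrite !comp_mpolyXU -!tnth_nth !tnth_mktuple expr2.
Qed.

(** A change of variables acts on quadratic forms by congruence. *)
Lemma form_matrix_pencil (x y : R) :
  form_matrix (x *: P + y *: Q) = A^T *m normal_matrix (1 / 2) x y *m A.
Proof.
have -> : P = 1 *: (L 0 * L 2) + (-1) *: (L 1 * L 1).
  by rewrite lin_subst_conic1 scale1r scaleN1r.
rewrite lin_subst_conic2 2!form_matrix_lin !form_matrixM.
apply/matrixP=> i j; rewrite !mxE !big_ord_recl big_ord0 !mxE.
rewrite !big_ord_recl !big_ord0 !mxE /=.
have -> : lift ord0 ord0 = 1 :> 'I_3 by apply: val_inj.
have -> : lift ord0 (lift ord0 ord0) = 2 :> 'I_3 by apply: val_inj.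
have -> : ord0 = 0 :> 'I_3 by apply: val_inj.
by field.
Qed.

Lemma meval_lin_subst (h : {mpoly R[3]}) (v : 'rV[R]_3) :
  (lin_subst A h).@[v 0] = h.@[(v *m A^T) 0].
Proof.
rewrite comp_mpoly_meval; apply: meval_eq => i.
rewrite tnth_mktuple raddf_sum !mxE; apply: eq_bigr => j _ /=.
by rewrite mevalZ mevalXU !mxE mulrC.
Qed.

Lemma meval_conic1 (w : 'rV[R]_3) :
  (orbitV_conic1 R).@[w 0] = w 0 0 * w 0 2 - w 0 1 ^+ 2.
Proof. by rewrite mevalB mevalM rmorphXn /= !mevalXU. Qed.

Lemma meval_conic2 (w : 'rV[R]_3) : (orbitV_conic2 R).@[w 0] = w 0 0 ^+ 2.
Proof. by rewrite rmorphXn /= !mevalXU. Qed.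

Lemma det_pencilE (a b c d : R) :
  det_pencil (a *: P + b *: Q) (c *: P + d *: Q) =
  ((\det A / 2) ^+ 2)%:MP * ('X_0 * a%:MP + 'X_1 * c%:MP) ^+ 3.
Proof.
rewrite /det_pencil !form_matrix_pencil !map_mxM !map_normal_matrix -map_trmx.
rewrite 2!(scalemxAl _ (_ *m _)) -mulmxDl 2!scalemxAr -mulmxDr.
rewrite normal_matrixD det_congruent_normal_matrix det_map_mx.
by rewrite -!rmorphM -rmorphXn mul1r.
Qed.

(** [Q] is the square of a linear form, so the trace of its matrix is the sum
    of the squares of the coefficients of that form. *)
Lemma tr_form_matrix_conic2 (x : R) :
  \tr (form_matrix (x *: Q)) = x * \sum_i A 0 i ^+ 2.
Proof.
rewrite -[x *: Q]add0r -(scale0r P) form_matrix_pencil mulr_sumr /mxtrace.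
apply: eq_bigr => i _; rewrite !mxE !big_ord_recl big_ord0 !mxE.
rewrite !big_ord_recl !big_ord0 !mxE /=.
by have -> : ord0 = 0 :> 'I_3 by []; ring.
Qed.

(** [P] cancels in the covariant, because the ratio [Phi12 : Phi21 = c : a] is
    the one that eliminates [P] between [f] and [g]. *)
Lemma T_invariantE (a b c d : R) :
  T_invariant (a *: P + b *: Q) (c *: P + d *: Q) =
  - (3 * (\det A / 2) ^+ 2 * (\sum_i A 0 i ^+ 2)) * (a * c * (a * d - b * c)).
Proof.
have [Phi12 Phi21] := mcoeff_cube ((\det A / 2) ^+ 2) a c.
rewrite /T_invariant /antisym_covariant /Phi det_pencilE Phi12 Phi21.
move: (_ ^+ 2) => k.
have -> : (3 * k * a * c ^+ 2) *: (a *: P + b *: Q) -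
    (3 * k * a ^+ 2 * c) *: (c *: P + d *: Q) =
    (3 * k * a * c * (b * c - a * d)) *: Q.
  by rewrite -!mul_mpolyC; ring.
by rewrite tr_form_matrix_conic2; ring.
Qed.

Lemma sum_row_sqr_gt0 (i : 'I_3) : A \in unitmx -> 0 < \sum_j A i j ^+ 2.
Proof.
move=> Au; rewrite lt0r sumr_ge0 ?andbT => [|j _]; last exact: sqr_ge0.
apply/negP; rewrite psumr_eq0 => [/allP Ai0|j _]; last exact: sqr_ge0.
move: Au; rewrite unitmxE (expand_det_row _ i) big1 ?unitr0 // => j _.
by have := Ai0 j (mem_index_enum j); rewrite sqrf_eq0 => /eqP ->; rewrite mul0r.
Qed.

(** The answer is the same for every point of [f = 0] off [g = 0]: eliminating
    [P] by [f = 0] turns [g] into a constant times [Q], and [Q] is a square. *)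
Lemma inside_on_zero_locus (a b c d : R) (v : 'rV[R]_3) :
    let f := a *: P + b *: Q in let g := c *: P + d *: Q in
    nondegenerate_form f -> nondegenerate_form g ->
    v \in zero_locus f -> v \notin zero_locus g ->
  (v \in inside g) = (0 < a * c * (a * d - b * c)).
Proof.
rewrite /nondegenerate_form !form_matrix_pencil !det_congruent_normal_matrix.
rewrite !inE form_matrix_pencil det_congruent_normal_matrix.
rewrite !mevalD !mevalZ !meval_lin_subst meval_conic2.
set p := (orbitV_conic1 R).@[_]; set x := (_ *m _) 0 0.
move: (\det A * _) => k ka kc /andP[v0 /eqP fv0] gv0; rewrite v0 /= in gv0 *.
rewrite sgr_eq_mulr_gt0 //.
move: ka kc; rewrite (mulf_eq0 _ (a ^+ 3)) (mulf_eq0 _ (c ^+ 3)) !expf_eq0 /= !negb_or.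
move=> /andP[k0 a0] /andP[_ c0].
have gvE : c * p + d * x ^+ 2 = (a * d - b * c) / a * x ^+ 2.
  apply: (mulfI a0).
  have -> : a * (c * p + d * x ^+ 2) =
    c * (a * p + b * x ^+ 2) + (a * d - b * c) * x ^+ 2 by ring.
  by rewrite fv0; field.
have x0 : x != 0.
  by apply: contraNneq gv0 => x0; rewrite gvE x0 expr0n mulr0.
have -> : (c * p + d * x ^+ 2) * (k ^+ 2 * c ^+ 3) =
    (k * c * x / a) ^+ 2 * (a * c * (a * d - b * c)).
  by rewrite gvE; field.
rewrite pmulr_rgt0 // exprn_even_gt0 //=.
by rewrite !mulf_neq0 ?invr_eq0.
Qed.

(** Without such a point, [lies_inside] would hold vacuously, whatever the sign
    of [a c e]. *)
Lemma exists_zero_locus_diff (a b c d : R) :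
    A \in unitmx -> a != 0 -> a * d - b * c != 0 ->
  exists2 v, v \in zero_locus (a *: P + b *: Q) &
             v \notin zero_locus (c *: P + d *: Q).
Proof.
move=> Au a0 e0.
(* In normal coordinates, (1 : 0 : - b / a) is the point of a P + b Q = 0 with
   x = 1 and y = 0; there Q = 1, hence P = - b / a. *)
pose w : 'rV[R]_3 := \row_j [:: 1; 0; - b / a]`_j.
have wE : w *m invmx A^T *m A^T = w by rewrite mulmxKV // unitmx_tr.
exists (w *m invmx A^T); rewrite !inE.
  apply/andP; split.
    apply/eqP => v0; move: wE; rewrite v0 mul0mx => /rowP/(_ 0).
    by rewrite !mxE /= => /esym/eqP; rewrite oner_eq0.
  rewrite !mevalD !mevalZ !meval_lin_subst wE meval_conic1 meval_conic2 !mxE /=.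
  by apply/eqP; field.
rewrite negb_and; apply/orP; right.
rewrite !mevalD !mevalZ !meval_lin_subst wE meval_conic1 meval_conic2 !mxE /=.
apply: contraNneq e0 => g0.
have -> : a * d - b * c =
    a * (c * (1 * (- b / a) - 0 ^+ 2) + d * 1 ^+ 2) by field.
by rewrite g0 mulr0.
Qed.

End RealConics.

Theorem proposition9 (R : realType) (f g : {mpoly R[3]})
    (hf : f \is 2.-homog) (hg : g \is 2.-homog)
    (ndf : nondegenerate_form f) (ndg : nondegenerate_form g)
    (hV : generate_pencil_in_orbitV f g) :
  lies_inside f g <-> T_invariant f g < 0.
Proof.
have [indep [A Au pencilE]] := hV.
have /pencilE [a [b fE]] : pencil f g f
  by exists 1, 0; rewrite scale1r scale0r addr0.
have /pencilE [c [d gE]] : pencil f g g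
  by exists 0, 1; rewrite scale1r scale0r add0r.
have a0 : a != 0.
  move: ndf; rewrite /nondegenerate_form fE form_matrix_pencil.
  rewrite det_congruent_normal_matrix.
  by apply: contraNneq => ->; rewrite expr0n mulr0.
(* If a d = b c, then c f - a g = 0, as it has no P term. *)
have e0 : a * d - b * c != 0.
  apply: contraNneq a0 => e0.
  have [|_ /eqP] := indep c (- a); last by rewrite oppr_eq0.
  rewrite fE gE -[RHS](scale0r (lin_subst A (orbitV_conic2 R))) -oppr0 -e0.
  by rewrite -!mul_mpolyC; ring.
have -> : T_invariant f g < 0 <-> 0 < a * c * (a * d - b * c).
  rewrite fE gE T_invariantE mulNr oppr_lt0 pmulr_rgt0 //.
  rewrite mulr_gt0 ?sum_row_sqr_gt0 // mulr_gt0 // exprn_even_gt0 //=.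
  by rewrite mulf_neq0 ?invr_eq0 ?pnatr_eq0 // -unitfE -unitmxE.
move: ndf ndg; rewrite fE gE => ndf' ndg'; split=> [f_in_g|pos v vf vg].
  have [v vf vg] := exists_zero_locus_diff Au a0 e0.
  by rewrite -(inside_on_zero_locus ndf' ndg' vf vg); apply: f_in_g.
by rewrite (inside_on_zero_locus ndf' ndg' vf vg).
Qed.
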